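(* Let $k=2$. There is an algorithm that, given a temporal star $(G_s,L)$ on $n$ vertices in which every edge has at most $2$ labels, computes a (partial) exploration of $(G_s,L)$ of maximum size (i.e.\ solves \textsc{MaxStarExp(2)}) in $O(n\log n)$ time.
   Context: A temporal graph is a pair $(G,L)$ where $G=(V,E)$ is a graph and $L:E\to 2^{\mathbb{N}}$ assigns to each edge a set of positive integer labels (the discrete times at which the edge is available). A temporal star is a temporal graph whose underlying graph $G_s$ is a star with center $c$ and $n-1$ leaves. A time edge is a triple $(u,v,l)$ with $\{u,v\}\in E$ and $l\in L(\{u,v\})$. A journey from $u$ to $v$ is a sequence of time edges $(u,u_1,l_1),(u_1,u_2,l_2),\dots,(u_{r-1},v,l_r)$ with $l_1<l_2<\dots<l_r$. A (partial) exploration of a temporal star is a journey that starts and ends at the center $c$; its size is the number of leaves it visits (equivalently, the number of edges of the star it explores, where an edge $\{c,v\}$ is explored by entering it from $c$ to $v$ at one of its labels and later exiting it from $v$ to $c$ at a strictly larger label). The problem \textsc{MaxStarExp($k$)} takes as input a temporal star in which every edge has at most $k$ labels and asks for a (partial) exploration of maximum size. *)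

(* Defs.v *)
From mathcomp Require Import all_boot.
Set Implicit Arguments. Unset Strict Implicit. Unset Printing Implicit Defensive.

(* A temporal star on n vertices: vertices 0..n-1, center 0, leaves 1..n-1;  *)
(* edge {0,v} (0 < v < n) carries the labels listed in L v (a finite set of   *)
(* positive integers, given as a duplicate-free list).                       *)

Definition labeling := nat -> seq nat.

Definition valid_star (k n : nat) (L : labeling) : Prop :=
  forall v, 0 < v < n -> [/\ size (L v) <= k, uniq (L v) & all (fun l => 0 < l) (L v)].

Definition tedge := (nat * nat * nat)%type.
Definition te_src (e : tedge) : nat := e.1.1.
Definition te_dst (e : tedge) : nat := e.1.2.
Definition te_lab (e : tedge) : nat := e.2.

Definition is_time_edge (n : nat) (L : labeling) (e : tedge) : bool :=
  let: (u, w, l) := e in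
  ((u == 0) && (0 < w < n) && (l \in L w)) || ((w == 0) && (0 < u < n) && (l \in L u)).

Definition journey_step (e f : tedge) : bool :=
  (te_dst e == te_src f) && (te_lab e < te_lab f).

Definition is_journey (n : nat) (L : labeling) (a b : nat) (s : seq tedge) : bool :=
  [&& all (is_time_edge n L) s, sorted journey_step s &
      match s with
      | [::] => a == b
      | e :: _ => (te_src e == a) && (te_dst (last e s) == b)
      end].

Definition is_exploration (n : nat) (L : labeling) (s : seq tedge) : bool :=
  is_journey n L 0 0 s.

Definition exploration_size (s : seq tedge) : nat :=
  size (undup [seq v <- map te_src s ++ map te_dst s | v != 0]).

Definition max_exploration (n : nat) (L : labeling) (s : seq tedge) : Prop :=
  is_exploration n L s /\
  forall s', is_exploration n L s' -> exploration_size s' <= exploration_size s.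

(* Machine model: unit-cost RAM with unbounded natural-number cells,          *)
(* direct/indirect addressing, addition, truncated subtraction and a         *)
(* conditional jump.  Each executed instruction costs one time unit.         *)

Inductive instr :=
| Cst of nat & nat
| Add of nat & nat & nat
| Sub of nat & nat & nat
| Ld  of nat & nat
| St  of nat & nat
| Jz  of nat & nat.

Definition program := seq instr.
Definition memory := nat -> nat.

Definition upd (m : memory) (a x : nat) : memory :=
  fun b => if b == a then x else m b.

Definition step (P : program) (c : nat * memory) : option (nat * memory) :=
  let: (pc, m) := c in
  match nth None (map Some P) pc with
  | None => None
  | Some (Cst i k) => Some (pc.+1, upd m i k)
  | Some (Add i j l) => Some (pc.+1, upd m i (m j + m l))
  | Some (Sub i j l) => Some (pc.+1, upd m i (m j - m l))
  | Some (Ld i j) => Some (pc.+1, upd m i (m (m j)))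
  | Some (St i j) => Some (pc.+1, upd m (m i) (m j))
  | Some (Jz i t) => Some (if m i == 0 then t else pc.+1, m)
  end.

Fixpoint run (P : program) (c : nat * memory) (t : nat) : option (nat * memory) :=
  match t with
  | 0 => Some c
  | t'.+1 => match step P c with Some c1 => run P c1 t' | None => None end
  end.

Definition halts_in (P : program) (m0 : memory) (t : nat) (m : memory) : Prop :=
  exists pc, run P (0, m0) t = Some (pc, m) /\ size P <= pc.

(* Input encoding of a temporal star: M[0] = n, and for each leaf 0 < v < n,
   M[3v+1], M[3v+2] hold the labels of edge {0,v} (0 = no label);
   all other cells are 0. *)
Definition encode_star (n : nat) (L : labeling) : memory :=
  fun a =>
    if a == 0 then n
    else let v := a %/ 3 in
         if (0 < v < n) && (a %% 3 != 0) then nth 0 (L v) (a %% 3).-1 else 0.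

Definition decode_journey (m : memory) : seq tedge :=
  let p := m 1 in
  [seq (m (p + 3 * i + 1), m (p + 3 * i + 2), m (p + 3 * i + 3)) | i <- iota 0 (m p)].

(* Main.v *)
Require Import Defs.
From mathcomp Require Import all_boot.
From mathcomp Require Import zify.
From Stdlib Require Import FunctionalExtensionality.
Set Implicit Arguments. Unset Strict Implicit. Unset Printing Implicit Defensive.

(* With at most two labels per edge, a leaf v can only be visited during the
   interval [enter v, leave v] between its two labels, so explorations are
   chains of disjoint intervals.  A maximum chain is found greedily: take the
   intervals by decreasing start and keep those that end before the start of
   the last one kept, so that the chain grows by its head.  The intervals are
   delivered by a tournament tree whose leaves are the star's vertices: the
   root holds a vertex of largest start, and inserting or erasing a leaf means
   replaying the O(log n) matches on its path to the root. *)

(** * Explorations as chains of intervals, and optimality of the greedy choice *)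

Section Greedy.

Variables (n : nat) (L : labeling).

Definition label v k := if 0 < v < n then nth 0 (L v) k else 0.

(* Minimum and maximum of the two labels, by truncated subtraction; [enter v]
   is 0 exactly when [v] has fewer than two labels. *)
Definition enter v := label v 0 - (label v 0 - label v 1).
Definition leave v := label v 1 + (label v 0 - label v 1).

Lemma enter_le_leave v : enter v <= leave v.
Proof. rewrite /enter /leave; lia. Qed.

Lemma leave_out v : ~~ (0 < v < n) -> leave v = 0.
Proof. by rewrite /leave /label => /negbTE ->. Qed.

Definition chain ws :=
  all (fun v => 0 < enter v) ws && sorted (fun u w => leave u < enter w) ws.

Lemma chain_cons v ws :
  chain (v :: ws) = [&& 0 < enter v, if ws is w :: _ then leave v < enter w else true & chain ws].
Proof.
rewrite /chain; case: ws => [|w ws] /=; first by rewrite !andbT.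
by case: (0 < enter v) => //=; case: (leave v < enter w); rewrite /= ?andbF.
Qed.

Lemma chain_lt v ws w : chain (v :: ws) -> w \in ws -> enter v < enter w.
Proof.
elim: ws v => // u ws IH v; rewrite chain_cons => /and3P[_ vu cu].
have lt_vu : enter v < enter u by apply: leq_ltn_trans (enter_le_leave v) vu.
rewrite inE => /orP[/eqP -> // | wws]; apply: ltn_trans lt_vu (IH _ cu wws).
Qed.

Lemma chain_uniq ws : chain ws -> uniq ws.
Proof.
elim: ws => // v ws IH cv /=; rewrite IH; last by move: cv; rewrite chain_cons => /and3P[].
by rewrite andbT; apply/negP => /(chain_lt cv); rewrite ltnn.
Qed.

Hypothesis valid : valid_star 2 n L.

Lemma enterP v : 0 < enter v ->
  [/\ 0 < v < n, enter v \in L v, leave v \in L v & enter v < leave v].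
Proof.
rewrite /enter /leave /label; case: ifP => // v_n; have [] := valid v_n.
case: (L v) => [|x [|y [|? ?]]] //=; try lia; move=> _.
by rewrite !inE; move=> xy xy0 e0; split=> //; lia.
Qed.

(** Two distinct labels exhaust an edge that carries at most two, so every visit of [v] takes up
    exactly its interval. *)
Lemma enter_leave_eq v l l' : 0 < v < n -> l \in L v -> l' \in L v -> l < l' ->
  [/\ 0 < enter v, enter v = l & leave v = l'].
Proof.
rewrite /enter /leave /label => v_n; rewrite v_n; have [] := valid v_n.
case: (L v) => [|x [|y [|? ?]]] //=; rewrite ?inE; try lia; move=> _.
by move=> xy xy0 lxy lxy' lt; split; lia.
Qed.

Definition visited (s : seq tedge) := [seq v <- map te_src s ++ map te_dst s | v != 0].

(** In a star each time edge out to a leaf is followed by one back, so the journey is peeled two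
    time edges at a time. The last clause strengthens the induction: a strict lower bound on the
    first label passes to the first interval, so another interval can be put in front. *)
Lemma exploration_chain s : is_exploration n L s ->
  exists ws, [/\ chain ws, {subset visited s <= ws} &
    forall l, (if s is e :: _ then l < te_lab e else true) ->
              if ws is w :: _ then l < enter w else true].
Proof.
have [k] := ubnP (size s); elim: k s => // k IH.
case=> [|[[u w] l] s] /= sz; first by exists [::].
rewrite /is_exploration /is_journey => /and3P[/= /andP[edge1 edges] steps /andP[/eqP u0 last0]].
rewrite /te_src /= in u0; subst u; move: edge1; rewrite eqxx /= andbF orbF => /andP[w_n lw].
(* A journey of a single time edge would end at the leaf [w], not at the center. *)
case: s sz edges steps last0 => [|[[u' w'] l'] s] sz /=.
  by move=> _ _; rewrite /te_dst /=; case/andP: w_n; case: (w).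
move=> /andP[edge2 edges] /andP[/andP[/eqP wu' ll'] steps] last0.
rewrite /te_src /te_dst /te_lab /= in wu' ll'; subst u'; move: edge2.
have w0 : (w == 0) = false by case/andP: w_n; case: (w).
rewrite w0 /= => /andP[/andP[/eqP w'0 _] l'w]; subst w'.
have [ew0 ew lew] := enter_leave_eq w_n lw l'w ll'.
have expl_s : is_exploration n L s.
  rewrite /is_exploration /is_journey edges (path_sorted steps) /=.
  case: (s) steps last0 => [|e r] //=; rewrite {1}/journey_step /te_dst /=.
  by move=> /andP[/andP[/eqP <- _] _] ->.
have sz_s : size s < k by move: sz => /=; lia.
have [ws [cws sub lws]] := IH s sz_s expl_s.
exists (w :: ws); split; last by move=> m; rewrite ew.
- rewrite chain_cons ew0 cws andbT /=; apply: lws; rewrite lew.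
  by case: (s) steps => [|e r] //= /andP[/andP[_ ]].
- move=> v; rewrite mem_filter => /andP[v0 /=].
  rewrite !(inE, mem_cat) (negbTE v0) /=; case: (v =P w) => //= _ vs.
  by apply: sub; rewrite mem_filter v0 mem_cat.
Qed.

Definition tour (ws : seq nat) : seq tedge :=
  flatten [seq [:: (0, v, enter v); (v, 0, leave v)] | v <- ws].

Lemma tour_exploration ws : chain ws -> is_exploration n L (tour ws).
Proof.
move=> cws; have journey_tour : all (is_time_edge n L) (tour ws)
    /\ sorted journey_step (tour ws).
  elim: ws cws => // v ws IH; rewrite chain_cons => /and3P[ev v_ws /IH[edges steps]].
  have [v_n ein lin lt] := enterP ev; split=> /=.
    by rewrite edges v_n ein lin /= ?orbT.
  rewrite {1}/journey_step /te_dst /te_src /te_lab /= eqxx lt /=.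
  by case: (ws) v_ws steps => //= w ws' vw ->; rewrite /journey_step /= vw.
case: journey_tour => edges steps; rewrite /is_exploration /is_journey edges steps /=.
case: ws {cws edges steps} => //= v ws; by elim: ws v => //= w ws IH v; apply: IH.
Qed.

Lemma tour_size ws : chain ws -> size ws <= exploration_size (tour ws).
Proof.
move=> cws; apply: uniq_leq_size; first exact: chain_uniq.
move=> v vws; rewrite mem_undup mem_filter; apply/andP; split.
  move/andP: cws => [/allP/(_ v vws) /enterP[v_n _ _ _] _]; lia.
elim: ws vws {cws} => //= w ws IH; rewrite !(inE, mem_cat).
case/orP => [/eqP -> | /IH]; first by rewrite /te_src /= eqxx !orbT.
by rewrite mem_cat => /orP[] ->; rewrite ?orbT.
Qed.

Lemma tour_max ws : chain ws -> (forall us, chain us -> size us <= size ws) ->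
  max_exploration n L (tour ws).
Proof.
move=> cws ws_max; split=> [|s /exploration_chain[us [cus sub _]]].
  exact: tour_exploration.
apply: leq_trans (tour_size cws); apply: leq_trans (ws_max _ cus).
apply: uniq_leq_size; first exact: undup_uniq.
by move=> v; rewrite mem_undup; apply: sub.
Qed.

(** Loop invariant: [R] holds the vertices still to come, [ws] the chain kept. By [greedy_ahead],
    [ws] is a longest chain of processed vertices, and among the longest ones its head starts as
    late as possible. *)
Record greedy (R : pred nat) (ws : seq nat) (bound : nat) : Prop := Greedy {
  greedy_chain : chain ws;
  greedy_nil : ws = [::] -> forall v, leave v < bound;
  greedy_head : forall w us, ws = w :: us -> bound = enter w;
  greedy_le : forall v, R v -> enter v <= bound;
  greedy_order : forall u v, ~~ R u -> R v -> 0 < enter u -> enter v <= enter u;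
  greedy_ahead : forall us, chain us -> all (predC R) us -> size us <= size ws
    /\ forall u vs, us = u :: vs -> bound < enter u -> size us < size ws }.

Lemma greedy0 b : (forall v, leave v < b) -> greedy predT [::] b.
Proof.
move=> lb; split=> //; first by move=> v _; apply: leq_trans (enter_le_leave v) (ltnW (lb v)).
by case=> //.
Qed.

Definition without (R : pred nat) v : pred nat := fun u => (u != v) && R u.

Section Pop.

Variables (R : pred nat) (ws : seq nat) (b v : nat).
Hypotheses (G : greedy R ws b) (Rv : R v) (ev : 0 < enter v).
Hypothesis v_max : forall u, R u -> enter u <= enter v.

Lemma without_order u w :
  ~~ without R v u -> without R v w -> 0 < enter u -> enter w <= enter u.
Proof.
rewrite /without negb_and negbK => /orP[/eqP -> | Ru] /andP[_ Rw] eu; first exact: v_max.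
exact: (greedy_order G).
Qed.

(** Processed vertices of positive start begin no earlier than [v], while starts increase strictly
    along a chain; hence [v] can only be the head. *)
Lemma chain_without us : chain us -> all (predC (without R v)) us ->
  all (predC R) us \/ exists2 vs, us = v :: vs & all (predC R) vs.
Proof.
have notin (ts : seq nat) : v \notin ts -> all (predC (without R v)) ts -> all (predC R) ts.
  move=> vts /allP allts; apply/allP => u uts; move: (allts u uts).
  rewrite /= /without; case: eqP => // uv; by rewrite -uv uts in vts.
case: us => [|u us] cus allus; first by left.
have v_us : v \notin us.
  apply/negP => v_us; have lt := chain_lt cus v_us.
  have eu : 0 < enter u by move: cus; rewrite chain_cons => /and3P[].
  have [uv|/eqP uv] := u =P v; first by rewrite uv ltnn in lt.
  have /allP/(_ u (mem_head _ _)) /= := allus; rewrite /without uv /= => Ru.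
  by have := greedy_order G Ru Rv eu; rewrite leqNgt lt.
move: allus => /= /andP[Ru /(notin _ v_us) allus].
have [uv|/eqP uv] := u =P v; first by right; exists us; rewrite ?uv.
by left; rewrite allus andbT; move: Ru; rewrite /without uv.
Qed.

Lemma greedy_accept : leave v < b -> greedy (without R v) (v :: ws) (enter v).
Proof.
move=> lvb; split=> //.
- rewrite chain_cons ev (greedy_chain G) andbT /=.
  by case E: ws => [|w us] //; rewrite -(greedy_head G E).
- by move=> w us [->].
- by move=> u /andP[_ /v_max].
- exact: without_order.
move=> us cus /(chain_without cus)[allus | [vs eus allvs]].
  have [le _] := greedy_ahead G cus allus; rewrite /=; split=> [|*]; lia.
move: cus; rewrite eus chain_cons => /and3P[_ _ cvs].
have [le _] := greedy_ahead G cvs allvs; split=> // u ts [-> _]; by rewrite ltnn.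
Qed.

(** In a chain [v :: vs], a nonempty [vs] starts after [leave v], hence after [b], so it is strictly
    shorter than [ws] and adding [v] gains nothing. *)
Lemma greedy_reject : b <= leave v -> greedy (without R v) ws b.
Proof.
move=> blv; have [w [us Ews]] : exists w us, ws = w :: us.
  case E: ws => [|w us]; last by exists w, us.
  by have := greedy_nil G E v; rewrite ltnNge blv.
split; [exact: greedy_chain G | exact: greedy_nil G | exact: greedy_head G | | | ].
- by move=> u /andP[_]; apply: (greedy_le G).
- exact: without_order.
move=> ts cts /(chain_without cts)[allts | [vs ets allvs]]; first exact: (greedy_ahead G).
move: cts; rewrite ets chain_cons => /and3P[_ v_vs cvs].
have [_ lt] := greedy_ahead G cvs allvs; split; last first.
  by move=> u ? [<- _]; rewrite ltnNge (greedy_le G Rv).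
case: vs v_vs lt {ets cvs allvs} => [|u vs] v_vs lt; first by rewrite Ews.
exact: (lt u vs erefl (leq_ltn_trans blv v_vs)).
Qed.

End Pop.

(** Pending vertices of start 0 occur in no chain, so the chains of processed vertices are all
    chains. *)
Lemma greedy_max R ws b : greedy R ws b -> (forall v, R v -> enter v = 0) ->
  max_exploration n L (tour ws).
Proof.
move=> G R0; apply: tour_max (greedy_chain G) _ => us cus.
apply: (proj1 (greedy_ahead G cus _)); case/andP: cus => /allP eus _.
by apply/allP => u /eus /=; case Ru: (R u) => //; rewrite (R0 u Ru).
Qed.

End Greedy.

Lemma upd_same m a x : upd m a x a = x.
Proof. by rewrite /upd eqxx. Qed.

Lemma upd_other m a x b : b <> a -> upd m a x b = m b.
Proof. by rewrite /upd; case: eqP. Qed.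

(** * Tournament trees *)

Section Tournament.

Variables (N : nat) (key : nat -> nat).

(** The comparison is the truncated difference that the machine can test for zero. *)
Definition win x y := if key y - key x == 0 then x else y.

(** While a path is replayed, at most the match at [c] is out of date; [c = 0] is no internal node
    and so stands for a consistent tree. *)
Definition tree_except (T : memory) c :=
  forall i, 0 < i < N -> i <> c -> T i = win (T (i + i)) (T (i + i).+1).

Lemma tree_leaf T j x : tree_except T 0 -> N <= j -> tree_except (upd T j x) j./2.
Proof. by move=> treeT Nj i iN ic; rewrite !upd_other; try lia; apply: treeT; lia. Qed.

(** Repairing node [c] can only invalidate the match at its parent; past the root the parent is
    0. *)
Lemma tree_replay T c : tree_except T c -> 0 < c < N ->
  tree_except (upd T c (win (T (c + c)) (T (c + c).+1))) c./2.
Proof.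
move=> treeT cN i iN ic; rewrite (upd_other _ _ (a := c) (b := i + i)); last lia.
rewrite (upd_other _ _ (b := (i + i).+1)); last lia.
by have [-> | /eqP ne] := i =P c; rewrite ?upd_same // upd_other; [apply: treeT|]; lia.
Qed.

Lemma win_ge x y : key x <= key (win x y) /\ key y <= key (win x y).
Proof. rewrite /win; case: eqP; lia. Qed.

Lemma tree_max T j : tree_except T 0 -> 0 < j < N + N -> key (T j) <= key (T 1).
Proof.
move=> treeT; have [k] := ubnP j; elim: k j => // k IH j jk jN.
have [-> // | /eqP j1] := j =P 1.
have lejp : key (T j) <= key (T j./2).
  rewrite (treeT j./2); [|lia|lia].
  have [l r] := win_ge (T (j./2 + j./2)) (T (j./2 + j./2).+1).
  by have [e | e] : j = j./2 + j./2 \/ j = (j./2 + j./2).+1 by [lia]; rewrite {1}e.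
apply: leq_trans lejp (IH _ _ _); lia.
Qed.

Lemma tree_mem T (Q : nat -> Prop) : 0 < N -> tree_except T 0 ->
  (forall j, N <= j < N + N -> Q (T j)) -> Q (T 1).
Proof.
move=> N0 treeT leaves; suff all_Q k j : N + N - j < k -> 0 < j < N + N -> Q (T j).
  by apply: (all_Q (N + N).+1); lia.
elim: k j => // k IH j jk jN; have [Nj | jN'] := leqP N j; first by apply: leaves; lia.
by rewrite treeT; try lia; rewrite /win; case: eqP => _; apply: IH; lia.
Qed.

End Tournament.

(* Registers sit at the multiples of 3 below 51, which no label of the input
   occupies. *)
Definition reg i := 3 * i.
Definition isreg a := (a %% 3 == 0) && (a < 51).

(** Overlaying an explicit list of registers on a heap lets execution update them by plain
    simplification. *)
Definition ram (rs : seq nat) (h : memory) : memory :=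
  fun a => if isreg a then nth 0 rs (a %/ 3) else h a.

Lemma ram_reg rs h i : i < 17 -> ram rs h (reg i) = nth 0 rs i.
Proof.
by rewrite /ram /isreg /reg => i17; rewrite modnMr mulKn //; case: ltnP => //; lia.
Qed.

Lemma ram_heap rs h a : ~~ isreg a -> ram rs h a = h a.
Proof. by rewrite /ram => /negbTE ->. Qed.

Lemma upd_reg rs h i x : i < 17 -> upd (ram rs h) (reg i) x = ram (set_nth 0 rs i x) h.
Proof.
move=> i17; apply: functional_extensionality => a; rewrite /upd.
case: eqP => [-> | ne]; first by rewrite ram_reg // nth_set_nth /= eqxx.
rewrite /ram; case: ifP => // /andP[a3 _]; rewrite nth_set_nth /=.
by case: eqP => // ai; case: ne; rewrite /reg; lia.
Qed.

Lemma upd_heap rs h a x : ~~ isreg a -> upd (ram rs h) a x = ram rs (upd h a x).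
Proof.
move=> ra; apply: functional_extensionality => b; rewrite /upd /ram.
by case: eqP => // ->; rewrite (negbTE ra).
Qed.

(** * Symbolic execution with a time bound *)

Section Reach.

Variable P : program.

(** An upper bound on the time, not an exact count, so that branches of different lengths can be
    joined. *)
Definition reach k c (Q : nat * memory -> Prop) :=
  exists t c', [/\ t <= k, run P c t = Some c' & Q c'].

Lemma reach_done k c (Q : nat * memory -> Prop) : Q c -> reach k c Q.
Proof. by move=> Qc; exists 0, c. Qed.

Lemma reach_le k k' c Q : k <= k' -> reach k c Q -> reach k' c Q.
Proof. by move=> kk' [t [c' [tk r q]]]; exists t, c'; split=> //; apply: leq_trans kk'. Qed.

Lemma reach_step k c c' Q : step P c = Some c' -> reach k c' Q -> reach k.+1 c Q.
Proof. by move=> s [t [c'' [tk r q]]]; exists t.+1, c''; split=> //=; rewrite s. Qed.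

Definition fetch pc := nth None (map Some P) pc.

Variables (k pc : nat) (rs : seq nat) (h : memory) (Q : nat * memory -> Prop).

Lemma reach_cst i x : fetch pc = Some (Cst (reg i) x) -> i < 17 ->
  reach k (pc.+1, ram (set_nth 0 rs i x) h) Q -> reach k.+1 (pc, ram rs h) Q.
Proof. by rewrite /fetch => f i17; apply: reach_step; rewrite /= f upd_reg. Qed.

Lemma reach_add i j l : fetch pc = Some (Add (reg i) (reg j) (reg l)) ->
  [&& i < 17, j < 17 & l < 17] ->
  reach k (pc.+1, ram (set_nth 0 rs i (nth 0 rs j + nth 0 rs l)) h) Q ->
  reach k.+1 (pc, ram rs h) Q.
Proof.
by rewrite /fetch => f /and3P[i17 j17 l17]; apply: reach_step; rewrite /= f upd_reg ?ram_reg.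
Qed.

Lemma reach_sub i j l : fetch pc = Some (Defs.Sub (reg i) (reg j) (reg l)) ->
  [&& i < 17, j < 17 & l < 17] ->
  reach k (pc.+1, ram (set_nth 0 rs i (nth 0 rs j - nth 0 rs l)) h) Q ->
  reach k.+1 (pc, ram rs h) Q.
Proof.
by rewrite /fetch => f /and3P[i17 j17 l17]; apply: reach_step; rewrite /= f upd_reg ?ram_reg.
Qed.

Lemma reach_ld i j : fetch pc = Some (Ld (reg i) (reg j)) ->
  (i < 17) && (j < 17) -> ~~ isreg (nth 0 rs j) ->
  reach k (pc.+1, ram (set_nth 0 rs i (h (nth 0 rs j))) h) Q ->
  reach k.+1 (pc, ram rs h) Q.
Proof.
rewrite /fetch => f /andP[i17 j17] nr; apply: reach_step.
by rewrite /= f upd_reg ?ram_reg // ram_heap.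
Qed.

Lemma reach_st i j : fetch pc = Some (St (reg i) (reg j)) ->
  (i < 17) && (j < 17) -> ~~ isreg (nth 0 rs i) ->
  reach k (pc.+1, ram rs (upd h (nth 0 rs i) (nth 0 rs j))) Q ->
  reach k.+1 (pc, ram rs h) Q.
Proof.
rewrite /fetch => f /andP[i17 j17] nr; apply: reach_step.
by rewrite /= f !ram_reg // upd_heap.
Qed.

Lemma reach_jz i t : fetch pc = Some (Jz (reg i) t) -> i < 17 ->
  (nth 0 rs i = 0 -> reach k (t, ram rs h) Q) ->
  (nth 0 rs i <> 0 -> reach k (pc.+1, ram rs h) Q) ->
  reach k.+1 (pc, ram rs h) Q.
Proof.
rewrite /fetch => f i17 H0 H1; have [e0 | ne0] := nth 0 rs i =P 0.
  by apply: reach_step (H0 e0); rewrite /= f ram_reg // e0.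
by apply: reach_step (H1 ne0); rewrite /= f ram_reg //; case: eqP.
Qed.

End Reach.

(* Registers: 0 N = n + 1, 1 zero, 2 one, 3-6 the bases of the arrays [enter],
   [leave], tree and parent, 7 loop counter, 8 start of the last interval kept
   (initially an upper bound on all labels), 9 number of time edges recorded,
   10 output pointer, which moves downwards, 11 tree node, 12-16 scratch.
   Node j has children 2j and 2j + 1, the root is 1, and vertex v is leaf N + v;
   vertex 0 and the padding vertex n have [enter] 0.  The parent array replaces
   the missing halving instruction. *)
Definition prog : program := [::
  Cst (reg 2) 1; Add (reg 0) (reg 0) (reg 2); Add (reg 12) (reg 0) (reg 0);
  Add (reg 12) (reg 12) (reg 0); Cst (reg 13) 51;
  Add (reg 3) (reg 12) (reg 13); Add (reg 4) (reg 3) (reg 0);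
  Add (reg 5) (reg 4) (reg 0); Add (reg 12) (reg 0) (reg 0);
  Add (reg 6) (reg 5) (reg 12); Add (reg 10) (reg 6) (reg 12);
  Add (reg 10) (reg 10) (reg 12); Add (reg 10) (reg 10) (reg 12);
  Add (reg 10) (reg 10) (reg 12); Cst (reg 8) 1; Add (reg 7) (reg 0) (reg 1);
  (* 16: fill the arrays enter, leave, parent *)
  Defs.Sub (reg 7) (reg 7) (reg 2); Jz (reg 7) 37;
  Add (reg 11) (reg 7) (reg 7); Add (reg 12) (reg 6) (reg 11);
  St (reg 12) (reg 7); Add (reg 12) (reg 12) (reg 2); St (reg 12) (reg 7);
  Add (reg 12) (reg 11) (reg 7); Add (reg 12) (reg 12) (reg 2);
  Ld (reg 13) (reg 12); Add (reg 12) (reg 12) (reg 2); Ld (reg 14) (reg 12);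
  Defs.Sub (reg 15) (reg 13) (reg 14); Defs.Sub (reg 13) (reg 13) (reg 15);
  Add (reg 14) (reg 14) (reg 15); Add (reg 8) (reg 8) (reg 14);
  Add (reg 12) (reg 3) (reg 7); St (reg 12) (reg 13);
  Add (reg 12) (reg 4) (reg 7); St (reg 12) (reg 14); Jz (reg 1) 16;
  Add (reg 7) (reg 0) (reg 1);
  (* 38: insert the next vertex *)
  Jz (reg 7) 44; Defs.Sub (reg 7) (reg 7) (reg 2);
  Add (reg 11) (reg 0) (reg 7); Add (reg 12) (reg 5) (reg 11);
  St (reg 12) (reg 7); Jz (reg 1) 71;
  (* 44: pop the root *)
  Add (reg 12) (reg 5) (reg 2); Ld (reg 13) (reg 12);
  Add (reg 12) (reg 3) (reg 13); Ld (reg 15) (reg 12); Jz (reg 15) 89;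
  Add (reg 12) (reg 4) (reg 13); Ld (reg 16) (reg 12);
  Add (reg 11) (reg 0) (reg 13); Add (reg 12) (reg 5) (reg 11);
  St (reg 12) (reg 1); Defs.Sub (reg 14) (reg 8) (reg 16); Jz (reg 14) 71;
  St (reg 10) (reg 16); Defs.Sub (reg 10) (reg 10) (reg 2);
  St (reg 10) (reg 1); Defs.Sub (reg 10) (reg 10) (reg 2);
  St (reg 10) (reg 13); Defs.Sub (reg 10) (reg 10) (reg 2);
  St (reg 10) (reg 15); Defs.Sub (reg 10) (reg 10) (reg 2);
  St (reg 10) (reg 13); Defs.Sub (reg 10) (reg 10) (reg 2);
  St (reg 10) (reg 1); Defs.Sub (reg 10) (reg 10) (reg 2);
  Add (reg 8) (reg 15) (reg 1); Add (reg 9) (reg 9) (reg 2);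
  Add (reg 9) (reg 9) (reg 2);
  (* 71: replay the path from leaf to root *)
  Add (reg 12) (reg 6) (reg 11); Ld (reg 11) (reg 12); Jz (reg 11) 38;
  Add (reg 12) (reg 11) (reg 11); Add (reg 12) (reg 5) (reg 12);
  Ld (reg 13) (reg 12); Add (reg 12) (reg 12) (reg 2); Ld (reg 14) (reg 12);
  Add (reg 12) (reg 3) (reg 13); Ld (reg 15) (reg 12);
  Add (reg 12) (reg 3) (reg 14); Ld (reg 16) (reg 12);
  Defs.Sub (reg 16) (reg 16) (reg 15); Jz (reg 16) 86;
  Add (reg 13) (reg 14) (reg 1); Add (reg 12) (reg 5) (reg 11);
  St (reg 12) (reg 13); Jz (reg 1) 71;
  (* 89: output *)
  St (reg 10) (reg 9); St (reg 2) (reg 10) ].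

Ltac exec :=
  first
    [ apply: reach_add; [reflexivity | reflexivity | rewrite /=]
    | apply: reach_sub; [reflexivity | reflexivity | rewrite /=]
    | apply: reach_cst; [reflexivity | reflexivity | rewrite /=]
    | apply: reach_ld; [reflexivity | reflexivity | rewrite /= /isreg; try lia | rewrite /=]
    | apply: reach_st; [reflexivity | reflexivity | rewrite /= /isreg; try lia | rewrite /=]
    | apply: reach_jz; [reflexivity | reflexivity | rewrite /= | rewrite /=] ].

Lemma count_without (R : pred nat) v s : v \in s -> R v ->
  count (without R v) s < count R s.
Proof.
move=> vs Rv; elim: s vs => //= u s IH; rewrite inE => /orP[/eqP <- | vs].
  by rewrite {1}/without eqxx Rv /= add0n ltnS; apply: sub_count => w /andP[].
have : without R v u <= R u by rewrite /without; case: (_ != _).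
by have := IH vs; lia.
Qed.

(** * Layout of the output journey *)

Section Output.

Variables (n : nat) (L : labeling).

(** Each vertex takes six cells, two time edges of three numbers. Records start just above [p],
    leaving cell [p] free for the final count of time edges. *)
Fixpoint recorded (m : memory) p ws : Prop :=
  if ws is v :: ws' then
    [/\ m (p + 1) = 0, m (p + 2) = v & m (p + 3) = enter n L v] /\
    [/\ m (p + 4) = v, m (p + 5) = 0 & m (p + 6) = leave n L v] /\
    recorded m (p + 6) ws'
  else True.

Lemma recorded_ext m m' p ws : (forall a, p < a -> m' a = m a) ->
  recorded m p ws -> recorded m' p ws.
Proof.
elim: ws p => //= v ws IH p eqm [r1 [r2 rws]].
have eqp c : m' (p + c.+1) = m (p + c.+1) by apply: eqm; lia.
by rewrite !eqp; do 2 split=> //; apply: IH rws => a pa; apply: eqm; lia.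
Qed.

Lemma decode_recorded m p ws : recorded m p ws -> m 1 = p ->
  m p = size ws + size ws -> decode_journey m = tour n L ws.
Proof.
rewrite /decode_journey => rws -> ->; elim: ws p rws => // v ws IH p [].
move=> [m1 m2 m3] [[m4 m5 m6] rws].
have -> : size (v :: ws) + size (v :: ws) = 2 + (size ws + size ws) by move=> /=; lia.
rewrite iotaD map_cat -[RHS]/([:: _; _] ++ tour n L ws) -(IH _ rws).
rewrite (iotaDl 2 0) -map_comp; congr (_ ++ _).
  by rewrite [iota 0 2]/= [LHS]/= -!addnA m1 m2 m3 m4 m5 m6.
by apply: eq_map => i /=; rewrite mulnDr !addnA.
Qed.

End Output.

(** * Correctness and running time of the program *)

Section Correctness.

Variables (n : nat) (L : labeling).
Hypothesis valid : valid_star 2 n L.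

Variables (N A E T P Out : nat).
Hypotheses (defN : N = n.+1) (defA : A = 3 * N + 51) (defE : E = A + N)
  (defT : T = E + N) (defP : P = T + (N + N)) (defOut : Out = P + (N + N)).

Local Notation enter := (enter n L).
Local Notation leave := (leave n L).

Local Notation state i last cnt p j t x y u w h :=
  (ram [:: N; 0; 1; A; E; T; P; i; last; cnt; p; j; t; x; y; u; w] h).

Record arrays (h tree : memory) : Prop := Arrays {
  arrays_enter : forall v, v < N -> h (A + v) = enter v;
  arrays_leave : forall v, v < N -> h (E + v) = leave v;
  arrays_tree : forall j, j < N + N -> h (T + j) = tree j;
  arrays_parent : forall j, j < N + N -> h (P + j) = j./2;
  tree_bound : forall j, tree j < N }.

Lemma arrays_set h tree j x : arrays h tree -> j < N + N -> x < N ->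
  arrays (upd h (T + j) x) (upd tree j x).
Proof.
move=> [hA hE hT hP ltN] jN xN; split=> [v vN|v vN|l lN|l lN|l].
- by rewrite upd_other; [apply: hA | lia].
- by rewrite upd_other; [apply: hE | lia].
- have [-> | /eqP ne] := l =P j; first by rewrite !upd_same.
  by rewrite !upd_other; [apply: hT | lia | lia].
- by rewrite upd_other; [apply: hP | lia].
- have [-> | /eqP ne] := l =P j; first by rewrite upd_same.
  by rewrite upd_other; [apply: ltN | lia].
Qed.

Lemma arrays_out h tree a x : arrays h tree -> Out <= a -> arrays (upd h a x) tree.
Proof.
move=> [hA hE hT hP ltN] Oa; split=> [v vN|v vN|l lN|l lN|//].
- by rewrite upd_other; [apply: hA | lia].
- by rewrite upd_other; [apply: hE | lia].
- by rewrite upd_other; [apply: hT | lia].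
- by rewrite upd_other; [apply: hP | lia].
Qed.

(** Each level costs 18 instructions and halves the node index, so [d] levels suffice below [2 ^ d];
    leaving the loop costs 3. The continuation gets a consistent tree with leaf entries and output
    cells untouched. *)
Lemma replay_reach d k Q h tree i last cnt p j t x y u w :
  arrays h tree -> tree_except N enter tree j./2 -> j < 2 ^ d -> j < N + N ->
  (forall h' tree' j' t' x' y' u' w', arrays h' tree' -> tree_except N enter tree' 0 ->
    (forall l, N <= l -> tree' l = tree l) -> (forall a, Out <= a -> h' a = h a) ->
    reach prog k (38, state i last cnt p j' t' x' y' u' w' h') Q) ->
  reach prog (18 * d + (3 + k)) (71, state i last cnt p j t x y u w h) Q.
Proof.
elim: d h tree j t x y u w => [|d IH] h tree j t x y u w arr treeT jd jN Hk.
  do 2 exec; have -> : h (P + j) = 0 by rewrite (arrays_parent arr); lia.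
  exec=> // _; apply: (Hk h tree) => //; suff <- : j./2 = 0 by []; lia.
have -> : 18 * d.+1 + (3 + k) = 18 + (18 * d + (3 + k)) by lia.
do 2 exec; rewrite (arrays_parent arr) //; exec=> [j0 | jn0].
  apply: (@reach_le _ k); first lia.
  by apply: (Hk h tree) => //; rewrite j0 in treeT.
set c := j./2 in treeT jn0 *.
have cN : 0 < c < N by lia.
do 3 exec; rewrite (arrays_tree arr); last lia.
do 2 exec; rewrite -(addnA T) addn1 (arrays_tree arr); last lia.
have ltl := tree_bound arr (c + c); have ltr := tree_bound arr (c + c).+1.
do 2 exec; rewrite (arrays_enter arr) //.
do 2 exec; rewrite (arrays_enter arr) //.
(* Both outcomes of the match rejoin here, with the winner stored at node [c]. *)
have step' t' x' y' u' w' h' : h' = upd h (T + c) (win enter (tree (c + c)) (tree (c + c).+1)) ->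
  reach prog (18 * d + (3 + k)) (71, state i last cnt p c t' x' y' u' w' h') Q.
  move=> -> {h'}; apply: (IH _ (upd tree c (win enter (tree (c + c)) (tree (c + c).+1)))).
  - apply: arrays_set => //; first lia.
    by rewrite /win; case: eqP.
  - exact: tree_replay.
  - by rewrite expnS in jd; lia.
  - lia.
  - move=> h' tree' {}j' {}t' {}x' {}y' {}u' {}w' arr' tree0 leaves out.
    apply: (Hk h' tree') => // [l Nl | a Oa].
      by rewrite leaves // upd_other //; lia.
    by rewrite out // upd_other //; lia.
do 2 exec.
  move=> z0; do 3 exec; last by [].
  move=> _; apply: (@reach_le _ (18 * d + (3 + k))); first lia.
  by apply: step'; rewrite /win z0.
move=> z0; do 4 exec; last by [].
by move=> _; apply: step'; rewrite /win addn0; case: eqP.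
Qed.

Definition solved (c : nat * memory) :=
  size prog <= c.1 /\ max_exploration n L (decode_journey c.2).

Variable D : nat.
Hypothesis lt_D : N + N <= 2 ^ D.

(** An empty leaf holds vertex 0, whose [enter] is 0, so a root of positive start must come from an
    inserted vertex. *)
Lemma root_inserted (R : pred nat) h tree : arrays h tree ->
  tree_except N enter tree 0 ->
  (forall v, v < N -> tree (N + v) = if R v then v else 0) ->
  0 < enter (tree 1) -> R (tree 1).
Proof.
move=> arr treeT leaves ev.
have : tree 1 = 0 \/ R (tree 1).
  apply: (tree_mem (Q := fun v => v = 0 \/ R v) _ treeT) => [|j jN]; first lia.
  have := leaves (j - N); have -> : N + (j - N) = j by lia.
  by case: ifP => [Rj -> | _ ->]; [right | lia | left | lia].
by case=> // v0; rewrite v0 in ev.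
Qed.

Lemma root_max (R : pred nat) tree v : tree_except N enter tree 0 ->
  (forall v, v < N -> tree (N + v) = if R v then v else 0) ->
  R v -> enter v <= enter (tree 1).
Proof.
move=> treeT leaves Rv; case: (ltnP v N) => [vN | Nv]; last first.
  by apply: leq_trans (enter_le_leave n L v) _; rewrite leave_out //; lia.
have <- : tree (N + v) = v by rewrite leaves // Rv.
by apply: tree_max treeT _; lia.
Qed.

Lemma output_reach (R : pred nat) ws h tree last cnt p j t x y u w :
  arrays h tree -> tree_except N enter tree 0 ->
  (forall v, v < N -> tree (N + v) = if R v then v else 0) ->
  greedy n L R ws last -> enter (tree 1) = 0 ->
  cnt = size ws + size ws -> recorded n L h p ws -> Out <= p ->
  reach prog 8 (38, state 0 last cnt p j t x y u w h) solved.
Proof.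
move=> arr treeT leaves G ev0 cntE rec pE.
exec=> // _; do 2 exec; rewrite (arrays_tree arr); last lia.
do 2 exec; rewrite (arrays_enter arr) ?(tree_bound arr) // ev0; exec=> // _.
(* Register 2 holds 1, so the last store puts the output pointer in cell 1, where decoding looks for
   it. *)
do 2 exec; apply: reach_done; split=> //=.
set m := ram _ _; have mE a : p <= a -> m a = upd (upd h p cnt) 1 p a.
  by move=> pa; rewrite /m ram_heap // /isreg; lia.
rewrite (@decode_recorded n L m p ws).
- apply: greedy_max valid _ _ _ G _ => v Rv.
  by have := root_max treeT leaves Rv; lia.
- by apply: recorded_ext rec => a pa; rewrite mE ?upd_other //; lia.
- by rewrite /m ram_heap // upd_same.
- by rewrite mE // upd_other ?upd_same //; lia.
Qed.

(** [mu] bounds the pending vertices and reserves six output cells for each. One pop takes at most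
    28 instructions and a replay; the final 8 pay for the output phase. *)
Lemma pop_reach mu (R : pred nat) ws h tree last cnt p j t x y u w :
  arrays h tree -> tree_except N enter tree 0 ->
  (forall v, v < N -> tree (N + v) = if R v then v else 0) ->
  greedy n L R ws last -> count R (iota 0 N) <= mu ->
  cnt = size ws + size ws -> recorded n L h p ws -> Out + 6 * mu <= p ->
  reach prog (mu * (18 * D + 31) + 8)
    (38, state 0 last cnt p j t x y u w h) solved.
Proof.
elim: mu R ws h tree last cnt p j t x y u w => [|mu IH] R ws h tree last cnt p j t x y u w
  arr treeT leaves G cntR cntE rec pE; (have [ev0 | /eqP] := enter (tree 1) =P 0;
  [by apply: (@reach_le _ 8); [lia | apply: (output_reach _ _ _ _ _ _ arr treeT leaves G) => //; lia] |]).
all: have vN := tree_bound arr 1; rewrite -lt0n => ev.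
all: have Rv := root_inserted arr treeT leaves ev.
all: have vin : tree 1 \in iota 0 N by rewrite mem_iota; lia.
all: have ltc := count_without vin Rv.
  lia.
have v_max u' := @root_max R tree u' treeT leaves.
rewrite mulSn; apply: (@reach_le _ (28 + (18 * D + (3 + (mu * (18 * D + 31) + 8))))); first lia.
exec=> // _; do 2 exec; rewrite (arrays_tree arr); last lia.
set v := tree 1 in vN ev Rv vin ltc v_max *.
do 2 exec; rewrite (arrays_enter arr) //; exec; first by move=> e0; rewrite e0 in ev.
move=> _; do 2 exec; rewrite (arrays_leave arr) //; do 4 exec.
set h1 := upd h (T + (N + v)) 0.
have arr1 : arrays h1 (upd tree (N + v) 0) by apply: arrays_set => //; lia.
have tree1 : tree_except N enter (upd tree (N + v) 0) (N + v)./2.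
  by apply: tree_leaf => //; lia.
have rec1 : recorded n L h1 p ws.
  by apply: recorded_ext rec => a pa; rewrite /h1 upd_other //; lia.
have leaves1 tree' : (forall l, N <= l -> tree' l = upd tree (N + v) 0 l) ->
    forall z, z < N -> tree' (N + z) = if without R v z then z else 0.
  move=> eqt z zN; rewrite eqt; last lia.
  rewrite /without; have [-> | /eqP ne] := z =P v; first by rewrite upd_same.
  by rewrite upd_other ?leaves //; lia.
(* The difference [last - leave v] vanishes exactly when the interval must be rejected. *)
exec=> [lt0 | lt0].
  apply: (@reach_le _ (18 * D + (3 + (mu * (18 * D + 31) + 8)))); first lia.
  apply: (replay_reach _ _ _ _ _ arr1 tree1) => [||h' tree' {}j {}t {}x {}y {}u {}w arr' treeT' eqt eqh]; try lia.
  apply: IH arr' treeT' (leaves1 _ eqt) (greedy_reject G Rv v_max _) _ cntE _ _; try lia.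
  by apply: recorded_ext rec1 => a pa; rewrite eqh //; lia.
do 15 exec.
set h2 := upd _ _ 0.
have arr2 : arrays h2 (upd tree (N + v) 0) by do 6 (apply: arrays_out; [|lia]).
apply: (@reach_le _ (18 * D + (3 + (mu * (18 * D + 31) + 8)))); first lia.
apply: (replay_reach _ _ _ _ _ arr2 tree1) => [||h' tree' {}j {}t {}x {}y {}u {}w arr' treeT' eqt eqh]; try lia.
rewrite addn0; apply: IH arr' treeT' (leaves1 _ eqt) (greedy_accept G Rv ev v_max _) _ _ _ _; try lia.
  by rewrite /=; lia.
(* The six decrements do not truncate, thanks to the room reserved above [Out]. *)
have pq : p = p - 1 - 1 - 1 - 1 - 1 - 1 + 6 by lia.
split; last split.
- by split; (rewrite eqh /h2 /upd; last lia); do ?case: eqP => ?; lia.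
- by split; (rewrite eqh /h2 /upd; last lia); do ?case: eqP => ?; lia.
rewrite -pq; apply: recorded_ext rec1 => a pa; rewrite eqh; last lia.
by rewrite /h2 !upd_other //; lia.
Qed.

Lemma insert_reach i k h tree last p j t x y u w :
  i <= N -> arrays h tree -> tree_except N enter tree 0 ->
  (forall v, v < N -> tree (N + v) = if i <= v then v else 0) ->
  (forall h tree j t x y u w, arrays h tree -> tree_except N enter tree 0 ->
    (forall v, v < N -> tree (N + v) = v) ->
    reach prog k (38, state 0 last 0 p j t x y u w h) solved) ->
  reach prog (i * (18 * D + 9) + k)
    (38, state i last 0 p j t x y u w h) solved.
Proof.
elim: i k h tree j t x y u w => [|i IH] k h tree j t x y u w iN arr treeT leaves Hk.
  by apply: (Hk h tree).
rewrite mulSn; apply: (@reach_le _ (6 + (18 * D + (3 + (i * (18 * D + 9) + k))))); first lia.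
exec=> // _; exec; rewrite subn1 /=.
do 4 exec; last by [].
move=> _; apply: (replay_reach (tree := upd tree (N + i) i)).
- by apply: arrays_set => //; lia.
- by apply: tree_leaf => //; lia.
- lia.
- lia.
move=> h' tree' {}j {}t {}x {}y {}u {}w arr' treeT' leaves' _.
apply: IH arr' treeT' _ Hk => [|v vN]; first lia.
rewrite leaves'; last lia.
have [-> | /eqP ne] := v =P i; first by rewrite upd_same leqnn.
rewrite upd_other; last lia.
rewrite leaves //; suff -> : (i < v) = (i <= v) by []; lia.
Qed.

(** Vertices from [i] upwards are loaded. The program adds every [leave] value to an initial 1, so
    [last] exceeds each of them. *)
Record loading i h last : Prop := Loading {
  loading_enter : forall v, v < N -> h (A + v) = if i <= v then enter v else 0;
  loading_leave : forall v, v < N -> h (E + v) = if i <= v then leave v else 0;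
  loading_tree : forall j, j < N + N -> h (T + j) = 0;
  loading_parent : forall j, j < N + N -> h (P + j) = if i + i <= j then j./2 else 0;
  loading_input : forall v, 0 < v < N ->
    h (3 * v + 1) = label n L v 0 /\ h (3 * v + 2) = label n L v 1;
  loading_bound : 0 < last /\ forall v, i <= v < N -> leave v < last }.

Lemma load_reach i k h last p j t x y u w :
  i < N -> loading i.+1 h last ->
  (forall h last j t x y u w, arrays h (fun=> 0) -> (forall v, leave v < last) ->
    reach prog k (38, state N last 0 p j t x y u w h) solved) ->
  reach prog (21 * i + (3 + k)) (16, state i.+1 last 0 p j t x y u w h) solved.
Proof.
elim: i h last j t x y u w => [|i IH] h last j t x y u w iN ld Hk.
  (* Vertex 0 needs no loading: its [enter] and [leave] are 0, and nodes 0 and 1 have parent 0, as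
     in the blank memory. *)
  exec; exec=> // _; exec; rewrite addn0; apply: Hk => [|v].
    case: ld => hA hE hT hP _ _; split=> [v vN|v vN|//|l lN|l]; last lia.
    - by rewrite hA //; case: v vN.
    - by rewrite hE //; case: v vN.
    by rewrite hP //; case: l lN => [|[|l]].
  have [last0 ltl] := loading_bound ld; case: (boolP (0 < v < N)) => vN; first exact: ltl.
  by rewrite leave_out //; lia.
have -> : 21 * i.+1 + (3 + k) = 21 + (21 * i + (3 + k)) by lia.
have [hA hE hT hP hI [last0 ltl]] := ld.
exec; rewrite subn1 /=; exec=> // _.
do 8 exec; rewrite !upd_other; try lia.
have [hx hy] := hI i.+1 iN.
have -> : i.+1 + i.+1 + i.+1 + 1 = 3 * i.+1 + 1 by lia.
rewrite hx; do 2 exec; rewrite !upd_other; try lia.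
rewrite -addnA addn1 hy; do 4 exec.
rewrite -/(enter i.+1) -/(leave i.+1).
do 5 exec; last by [].
move=> _; apply: IH Hk; first lia.
split=> [v vN|v vN|l lN|l lN|v vN|]; last first.
- split=> [|v vN]; first lia.
  by have [-> | /eqP ne] := v =P i.+1; [lia | have := ltl v; lia].
- by rewrite !upd_other; [apply: hI | lia..].
- have [-> | /eqP ne1] := l =P (i.+1 + i.+1).+1.
    by do 2 (rewrite upd_other; last lia); rewrite -(addnA P) addn1 upd_same leqnSn; lia.
  have [-> | /eqP ne2] := l =P i.+1 + i.+1.
    by do 3 (rewrite upd_other; last lia); rewrite upd_same leqnn; lia.
  rewrite !upd_other; try lia; rewrite hP //.
  suff -> : (i.+2 + i.+2 <= l) = (i.+1 + i.+1 <= l) by []; lia.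
- by rewrite !upd_other; [apply: hT | lia..].
- have [-> | /eqP ne] := v =P i.+1; first by rewrite upd_same leqnn.
  rewrite !upd_other; try lia; rewrite hE //.
  suff -> : (i.+1 < v) = (i.+1 <= v) by []; lia.
have [-> | /eqP ne] := v =P i.+1; first by rewrite upd_other ?upd_same ?leqnn //; lia.
rewrite !upd_other; try lia; rewrite hA //.
suff -> : (i.+1 < v) = (i.+1 <= v) by []; lia.
Qed.

Lemma encode_input v k : 0 < v -> k < 2 -> encode_star n L (3 * v + k.+1) = label n L v k.
Proof.
move=> v0 k2; rewrite /encode_star /label; case: eqP => [|_]; first lia.
have -> : (3 * v + k.+1) %/ 3 = v by lia.
by have -> : (3 * v + k.+1) %% 3 = k.+1 by [lia]; rewrite /= andbT.
Qed.

Lemma encode_zero a : 0 < a -> 3 * n <= a \/ a %% 3 = 0 -> encode_star n L a = 0.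
Proof.
rewrite /encode_star => a0 a3; case: eqP => [|_]; first lia.
by case: ifP => //; lia.
Qed.

Lemma encode_ram : encode_star n L = ram (n :: nseq 16 0) (encode_star n L).
Proof.
apply: functional_extensionality => a; rewrite /ram; case: ifP => // /andP[/eqP a3 a51].
case: (posnP a) => [-> // | a0]; rewrite encode_zero //; last by right.
have -> : a %/ 3 = (a %/ 3).-1.+1 by lia.
by rewrite -[RHS]/(nth 0 (nseq 16 0) (a %/ 3).-1) nth_nseq if_same.
Qed.

Lemma prog_reach :
  reach prog (N * (36 * D + 61) + 27) (0, encode_star n L) solved.
Proof.
have -> : encode_star n L = ram [:: n; 0; 0; 0; 0; 0; 0; 0; 0; 0; 0; 0; 0; 0; 0; 0; 0] (encode_star n L).
  exact: encode_ram.
(* Set-up, loading, one insertion per vertex, then at most one pop per vertex and the output. *)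
apply: (@reach_le _ (16 + (21 * n + (3 + (N * (18 * D + 9) + (N * (18 * D + 31) + 8)))))).
  by rewrite defN; lia.
do 2 exec; rewrite addn1 -defN.
do 4 exec; have -> : N + N + N + 51 = A by lia.
do 2 exec; rewrite -defE -defT.
do 3 exec; rewrite -defP.
(* The output pointer ends at [Out + 6 * N], room for one record per vertex. *)
do 5 exec; rewrite addn0; have load := @load_reach n; rewrite -defN in load.
have input_zero a : 3 * n <= a -> 0 < a -> encode_star n L a = 0.
  by move=> na a0; apply: encode_zero => //; left.
apply: load => [||h last j t x y u w arr ltl]; first lia.
  split=> [v vN|v vN|j jN|j jN|v vN|].
  - by rewrite input_zero; [case: leqP; lia|lia..].
  - by rewrite input_zero; [case: leqP; lia|lia..].
  - by rewrite input_zero; lia.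
  - by rewrite input_zero; [case: leqP; lia|lia..].
  - by rewrite !encode_input //; lia.
  - by split=> // v vN; lia.
apply: insert_reach arr _ _ _ => //.
  by move=> v vN; rewrite leqNgt vN.
move=> {}h tree {}j {}t {}x {}y {}u {}w arr treeT leaves.
apply: (@pop_reach _ predT [::] _ tree) => //.
- exact: greedy0.
- by rewrite count_predT size_iota.
lia.
Qed.

End Correctness.

(* MaxStarExp(2) is solvable in O(n log n) time on a unit-cost RAM. *)
Theorem theorem1 :
  exists (P : program) (C : nat),
    forall (n : nat) (L : labeling),
      valid_star 2 n L ->
      exists (t : nat) (m : memory),
        [/\ halts_in P (encode_star n L) t m,
            t <= C * (n.+1 * (trunc_log 2 n).+1) &
            max_exploration n L (decode_journey m)].
Proof.
(* With [D = d.+2] the bound is [n.+1 * (36 * d + 133) + 27], and 133 + 27 = 160. *)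
exists prog, 160 => n L valid; set d := trunc_log 2 n.
(* From [n < 2 ^ d.+1]: two more doublings than [d] cover all tree indices. *)
have lt_D : n.+1 + n.+1 <= 2 ^ d.+2.
  by have := trunc_log_ltn n (isT : 1 < 2); rewrite -/d [2 ^ d.+2]expnS; lia.
have [t [[pc m] [tk r [pcP opt]]]] :=
  prog_reach valid erefl erefl erefl erefl erefl erefl lt_D.
exists t, m; split=> //; first by exists pc.
by apply: leq_trans tk _; lia.
Qed.
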